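(* Let $\mathfrak X,\mathfrak Y$ be Polish spaces, and let $\mu,\nu$ be probability measures on $\mathfrak X,\mathfrak Y$ respectively. Suppose that the cost function $c:(\mathfrak X\times\mathfrak Y)^2\to\mathbb R$ is of the form $c(x,y,x',y')=h(f(x,x'),g(y,y'))$ for some $h:\mathbb R^2\to\mathbb R$, $f:\mathfrak X^2\to\mathbb R$ and $g:\mathfrak Y^2\to\mathbb R$. Let $\mu_f$ be the law of $f(X,X')$ for $X,X'$ independent with law $\mu$, and let $\nu_g$ be the law of $g(Y,Y')$ for $Y,Y'$ independent with law $\nu$. Then $$\inf_{\pi\in\Pi(\mu,\nu)}\iint c(x,y,x',y')\,\mathrm d\pi(x,y)\,\mathrm d\pi(x',y')\ \ge\ \inf_{\hat\pi\in\Pi(\mu_f,\nu_g)}\int h(\xi,\zeta)\,\mathrm d\hat\pi(\xi,\zeta).$$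
   Context: For probability measures $\alpha,\beta$, $\Pi(\alpha,\beta)$ is the set of all probability measures on the product space with marginals $\alpha$ and $\beta$. The functions $f,g,h$ are assumed measurable, and infima are taken over those couplings for which the integral is well-defined (possibly infinite). *)

(* Defs.v *)
From HB Require Import structures.
From mathcomp Require Import all_boot all_order all_algebra.
From mathcomp Require Import all_classical all_reals all_analysis.

Set Implicit Arguments.
Unset Strict Implicit.
Unset Printing Implicit Defensive.

Import Order.TTheory GRing.Theory Num.Theory.
Import numFieldNormedType.Exports.

Local Open Scope classical_set_scope.
Local Open Scope ring_scope.

Section polish.
Context (R : realType) (T : topologicalType).

Definition is_distance (dist : T -> T -> R) : Prop :=
  [/\ forall x y, 0 <= dist x y,
      forall x y, dist x y = 0 <-> x = y,
      forall x y, dist x y = dist y x &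
      forall x y z, dist x z <= dist x y + dist y z].

Definition induces_topology (dist : T -> T -> R) : Prop :=
  forall A : set T, open A <->
    forall x, A x -> exists2 e : R, 0 < e & [set y | dist x y < e] `<=` A.

Definition complete_distance (dist : T -> T -> R) : Prop :=
  forall u : nat -> T,
    (forall e : R, 0 < e -> exists N : nat, forall m n : nat,
       (N <= m)%N -> (N <= n)%N -> dist (u m) (u n) < e) ->
    exists l : T, forall e : R, 0 < e -> exists N : nat, forall n : nat,
      (N <= n)%N -> dist (u n) l < e.

Definition separable : Prop := exists2 D : set T, countable D & dense D.

Definition polish : Prop :=
  separable /\
  exists dist : T -> T -> R,
    [/\ is_distance dist, induces_topology dist & complete_distance dist].

End polish.

(* On a product of second countable spaces, the product of the Borel
   sigma-algebras, which is the library's measurable structure on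
   [borel X * borel Y], is the Borel sigma-algebra of the product topology.
   The library requires measurable types to be pointed; this excludes only the
   empty space, which carries no probability measure. *)
Notation borel T := (g_sigma_algebraType (@open T)).

Section couplings.
Context d1 d2 (T1 : measurableType d1) (T2 : measurableType d2) (R : realType).

Definition coupling (alpha : probability T1 R) (beta : probability T2 R) :
    set (probability (T1 * T2)%type R) :=
  [set pi : probability (T1 * T2)%type R |
    (forall A : set T1, measurable A -> pi (A `*` [set: T2]) = alpha A) /\
    (forall B : set T2, measurable B -> pi ([set: T1] `*` B) = beta B)].

End couplings.

Section integral_well_defined.
Local Open Scope ereal_scope.
Context d (T : measurableType d) (R : realType).

(* The library's integral is total, with value -oo when the positive and the
   negative parts both have infinite integral. *)
Definition integral_well_defined (m : set T -> \bar R) (F : T -> \bar R) :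
    Prop :=
  ~ (\int[m]_x F^\+ x = +oo /\ \int[m]_x F^\- x = +oo).

End integral_well_defined.

Section law_of_iid_pair.
Context d (T : measurableType d) (R : realType).

Definition independent_rv d0 (Omega : measurableType d0)
    (P : probability Omega R) (Z Z' : {mfun Omega >-> T}) : Prop :=
  forall A B : set T, measurable A -> measurable B ->
    P (Z @^-1` A `&` Z' @^-1` B) = (P (Z @^-1` A) * P (Z' @^-1` B))%E.

Definition has_law d0 (Omega : measurableType d0)
    (P : probability Omega R) (Z : {mfun Omega >-> T}) (mu : probability T R) :
    Prop :=
  forall A : set T, measurable A -> distribution P Z A = mu A.

Definition is_law_of_iid_pair (mu : probability T R) (f : T * T -> R)
    (m : probability R R) : Prop :=
  exists d0 (Omega : measurableType d0) (P : probability Omega R)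
      (Z Z' : {mfun Omega >-> T}),
    [/\ has_law P Z mu, has_law P Z' mu, independent_rv P Z Z' &
        forall B : set R, measurable B ->
          m B = P ((fun w => f (Z w, Z' w)) @^-1` B)].

End law_of_iid_pair.

(* Main.v *)
Require Import Defs.
From HB Require Import structures.
From mathcomp Require Import all_boot all_order all_algebra.
From mathcomp Require Import all_classical all_reals all_analysis.
From mathcomp Require Import measurable_realfun.

Set Implicit Arguments.
Unset Strict Implicit.
Unset Printing Implicit Defensive.

Import Order.TTheory GRing.Theory Num.Theory.
Import numFieldNormedType.Exports.

Local Open Scope classical_set_scope.
Local Open Scope ring_scope.

(** The product of two copies of a coupling [pi] of [mu] and [nu] is the law of
    two independent pairs (X, Y) and (X', Y'), and the law of
    (f(X, X'), g(Y, Y')) is then a coupling of [mu_f] and [nu_g]: its first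
    marginal involves only X and X', which are independent with law [mu], and
    symmetrically for the second one. By change of variables this coupling has
    [h]-cost equal to the [c]-cost of [pi], so every value on the left-hand side
    of the inequality is also a value on the right-hand side, and the infimum
    over the larger set of values is smaller.

    The independent copies in the definition of [mu_f] live on an unspecified
    probability space, so the marginals are compared through the product
    measure: two random elements satisfying the product rule on rectangles
    have the product measure as joint law ([joint_law_of_product_rule]), which
    applies both to that space ([law_of_iid_pairE]) and to the product of [pi]
    with itself. Since [c] may fail to be integrable, the change of variables is
    done separately on positive and negative parts
    ([integral_distribution_parts]); this transports both the value of the
    integral and the fact that it is well defined. *)

Section joint_law.
Context d d1 d2 (Omega : measurableType d) (T1 : measurableType d1)
  (T2 : measurableType d2) (R : realType).

(** Rectangles generate the product sigma-algebra and are stable under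
    intersection, whence the uniqueness of the product measure. *)
Lemma joint_law_of_product_rule (P : probability Omega R)
    (alpha : probability T1 R) (beta : probability T2 R)
    (Z : Omega -> T1) (Z' : Omega -> T2) :
    measurable_fun [set: Omega] Z -> measurable_fun [set: Omega] Z' ->
    (forall A B, measurable A -> measurable B ->
      P (Z @^-1` A `&` Z' @^-1` B) = (alpha A * beta B)%E) ->
  forall C : set (T1 * T2), measurable C ->
    P ((fun w => (Z w, Z' w)) @^-1` C) = (alpha \x beta)%E C.
Proof.
move=> mZ mZ' PZ C mC; have mW := measurable_fun_pair mZ mZ'.
pose W : {mfun Omega >-> (T1 * T2)%type} :=
  HB.pack (fun w => (Z w, Z' w)) (isMeasurableFun.Build _ _ _ _ _ mW).
apply/esym; exact: (product_measure_unique (m' := distribution P W)).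
Qed.

End joint_law.

Section iid_pair.
Context d (T : measurableType d) (R : realType).

Lemma law_of_iid_pairE (mu : probability T R) (f : T * T -> R)
    (m : probability R R) : measurable_fun [set: T * T] f ->
  is_law_of_iid_pair mu f m ->
  forall B, measurable B -> m B = (mu \x mu)%E (f @^-1` B).
Proof.
move=> mf [d0 [Om [P [Z [Z' [Zmu Z'mu ZZ' mE]]]]]] B mB; rewrite mE//.
rewrite -(joint_law_of_product_rule (P := P) (Z := Z) (Z' := Z'))//.
- by move=> A A' mA mA'; rewrite ZZ'// -Zmu// -Z'mu.
- by rewrite -[X in measurable X]setTI; exact: mf.
Qed.

End iid_pair.

Section change_of_variables.
Context d d' (T : measurableType d) (T' : measurableType d') (R : realType).
Variables (P : probability T R) (phi : {mfun T >-> T'}) (F : T' -> \bar R).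
Hypothesis mF : measurable_fun [set: T'] F.
Local Open Scope ereal_scope.

(** The change of variables formula holds for every nonnegative measurable
    function, hence for each part of [F], whether or not its integral is
    finite. *)
Lemma integral_distribution_parts :
  \int[distribution P phi]_y F^\+ y = \int[P]_x (F \o phi)^\+ x /\
  \int[distribution P phi]_y F^\- y = \int[P]_x (F \o phi)^\- x.
Proof.
rewrite (funepos_comp F phi) (funeneg_comp F phi); split.
- rewrite ge0_integral_pushforward ?preimage_setT//.
  exact: measurable_funepos.
- rewrite ge0_integral_pushforward ?preimage_setT//.
  exact: measurable_funeneg.
Qed.

(** Both sides are the difference of the same two extended reals, so they
    agree even when that difference is infinite or of the form oo - oo. *)
Lemma integral_distribution :
  \int[distribution P phi]_y F y = \int[P]_x (F \o phi) x.
Proof.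
have [pE nE] := integral_distribution_parts.
by rewrite integralE pE nE -integralE.
Qed.

Lemma integral_well_defined_distribution :
  integral_well_defined P (F \o phi) ->
  integral_well_defined (distribution P phi) F.
Proof.
have [pE nE] := integral_distribution_parts.
by rewrite /integral_well_defined pE nE.
Qed.

End change_of_variables.

Section coupling_of_pairs.
Context d1 d2 (T1 : measurableType d1) (T2 : measurableType d2) (R : realType).
Variables (mu : probability T1 R) (nu : probability T2 R).
Variable pi : probability (T1 * T2)%type R.
Hypothesis pi_coupling : coupling mu nu pi.

(** In the product space of two pairs, the event that the first coordinates lie
    in A and B respectively is the rectangle of the cylinders over A and B, to
    which [pi] gives the masses [mu A] and [mu B]; the first coordinates are
    thus independent with law [mu], however strongly [pi] ties them to the
    second ones. *)
Lemma coupling_square_fst (C : set (T1 * T1)) : measurable C ->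
  (pi \x pi)%E ((fun z => (z.1.1, z.2.1)) @^-1` C) = (mu \x mu)%E C.
Proof.
have [pi1 _] := pi_coupling.
apply: (joint_law_of_product_rule (P := (pi \x pi)%E)).
- exact: measurableT_comp.
- exact: measurableT_comp.
move=> A B mA mB; rewrite -pi1// -(pi1 B)//.
rewrite -product_measure1E; [|exact: measurableX..].
by congr (product_measure1 _ _ _); apply/seteqP; split=> -[[a b] [a' b']] //=;
  [move=> []|move=> [[? _] []]].
Qed.

Lemma coupling_square_snd (C : set (T2 * T2)) : measurable C ->
  (pi \x pi)%E ((fun z => (z.1.2, z.2.2)) @^-1` C) = (nu \x nu)%E C.
Proof.
have [_ pi2] := pi_coupling.
apply: (joint_law_of_product_rule (P := (pi \x pi)%E)).
- exact: measurableT_comp.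
- exact: measurableT_comp.
move=> A B mA mB; rewrite -pi2// -(pi2 B)//.
rewrite -product_measure1E; [|exact: measurableX..].
by congr (product_measure1 _ _ _); apply/seteqP; split=> -[[a b] [a' b']] //=;
  [move=> []|move=> [[_ ?] []]].
Qed.

Variables (f : T1 * T1 -> R) (g : T2 * T2 -> R).
Hypotheses (mf : measurable_fun [set: T1 * T1] f)
  (mg : measurable_fun [set: T2 * T2] g).

Let pair_values (z : (T1 * T2) * (T1 * T2)) : R * R :=
  (f (z.1.1, z.2.1), g (z.1.2, z.2.2)).

Let measurable_pair_values : measurable_fun setT pair_values.
Proof.
apply: measurable_fun_pair.
- by apply: (measurableT_comp mf); apply: measurable_fun_pair;
    exact: measurableT_comp.
- by apply: (measurableT_comp mg); apply: measurable_fun_pair;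
    exact: measurableT_comp.
Qed.

Definition pair_values_mfun :
    {mfun ((T1 * T2) * (T1 * T2))%type >-> (R * R)%type} :=
  HB.pack pair_values
    (isMeasurableFun.Build _ _ _ _ _ measurable_pair_values).

(** Each marginal of the law of (f(X, X'), g(Y, Y')) only sees one side of the
    two pairs, on which the two copies are independent. *)
Lemma coupling_pair_values (mu_f nu_g : probability R R) :
  is_law_of_iid_pair mu f mu_f -> is_law_of_iid_pair nu g nu_g ->
  coupling mu_f nu_g (distribution (pi \x pi)%E pair_values_mfun).
Proof.
move=> muf nug; split=> [A mA|B mB]; rewrite /distribution /pushforward.
- rewrite (law_of_iid_pairE mf muf)// -coupling_square_fst.
    by congr (product_measure1 _ _ _); apply/seteqP; split=> z //= [].
  by rewrite -[X in measurable X]setTI; exact: mf.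
- rewrite (law_of_iid_pairE mg nug)// -coupling_square_snd.
    by congr (product_measure1 _ _ _); apply/seteqP; split=> z //= [].
  by rewrite -[X in measurable X]setTI; exact: mg.
Qed.

End coupling_of_pairs.

Theorem proposition5 (R : realType) (X Y : ptopologicalType)
    (polishX : polish R X) (polishY : polish R Y)
    (mu : probability (borel X) R) (nu : probability (borel Y) R)
    (f : borel X * borel X -> R) (g : borel Y * borel Y -> R)
    (h : R * R -> R)
    (mf : measurable_fun [set: borel X * borel X] f)
    (mg : measurable_fun [set: borel Y * borel Y] g)
    (mh : measurable_fun [set: R * R] h)
    (c : (borel X * borel Y) * (borel X * borel Y) -> R)
    (hc : forall (x : X) (y : Y) (x' : X) (y' : Y),
      c ((x, y), (x', y')) = h (f (x, x'), g (y, y')))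
    (mu_f nu_g : probability R R)
    (hmu_f : is_law_of_iid_pair mu f mu_f)
    (hnu_g : is_law_of_iid_pair nu g nu_g) :
  (ereal_inf [set \int[pi \x pi]_z (c z)%:E | pi in
       [set pi : probability (borel X * borel Y)%type R |
         coupling mu nu pi /\
         integral_well_defined (pi \x pi) (EFin \o c)]]
   >=
   ereal_inf [set \int[pihat]_w (h w)%:E | pihat in
       [set pihat : probability (R * R)%type R |
         coupling mu_f nu_g pihat /\
         integral_well_defined pihat (EFin \o h)]])%E.
Proof.
apply: ereal_inf_le_tmp => _ [pi [cpi wpi] <-].
have cE : EFin \o c = (EFin \o h) \o pair_values_mfun mf mg.
  by apply/funext => -[[x y] [x' y']] /=; rewrite hc.
have mhE : measurable_fun setT (EFin \o h) by exact/measurable_EFinP.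
exists (distribution (pi \x pi)%E (pair_values_mfun mf mg)); first split.
- exact: (coupling_pair_values cpi mf mg).
- by apply: integral_well_defined_distribution; rewrite -?cE.
- by rewrite (integral_distribution _ _ mhE) -cE.
Qed.
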